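(* For $p=100$, we have $$C_p(x,y)=\frac{1-2x-x^2y+x^3}{1-3x+x^2-x^2y+2x^3}.$$
   Context: A Catalan word of length $n\geq 1$ is a word $w_1\ldots w_n$ over the non-negative integers with $w_1=0$ and $0\leq w_i\leq w_{i-1}+1$ for $2\leq i\leq n$; the empty word is the unique Catalan word of length $0$. A word $w$ contains the pattern $p=p_1\ldots p_k$ if there are indices $i_1<\cdots<i_k$ such that $w_{i_1}\ldots w_{i_k}$ is order-isomorphic to $p$ (for all $a,b$: $w_{i_a}<w_{i_b}$ iff $p_a<p_b$, and $w_{i_a}=w_{i_b}$ iff $p_a=p_b$); otherwise $w$ avoids $p$. $\mathcal{C}_n(p)$ is the set of Catalan words of length $n$ avoiding $p$. A descent of $w$ is an index $i$ with $w_i>w_{i+1}$. $C_p(x,y)=\sum_{n,k\geq 0}c_{n,k}x^ny^k$, where $c_{n,k}$ is the number of words in $\mathcal{C}_n(p)$ with exactly $k$ descents. *)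

(* Defs.v *)
From mathcomp Require Import all_boot all_order all_algebra.
Set Implicit Arguments.
Unset Strict Implicit.
Unset Printing Implicit Defensive.
Import Order.TTheory GRing.Theory Num.Theory.

Definition catalan (w : seq nat) : bool :=
  (head 0 w == 0) && sorted (fun a b => b <= a.+1) w.

(* f lists the positions i_1 < ... < i_k of the occurrence. *)
Definition contains (p w : seq nat) : bool :=
  [exists f : {ffun 'I_(size p) -> 'I_(size w)},
    [forall a : 'I_(size p), forall b : 'I_(size p),
      [&& (a < b) ==> (f a < f b),
          (nth 0 w (f a) < nth 0 w (f b)) == (nth 0 p a < nth 0 p b) &
          (nth 0 w (f a) == nth 0 w (f b)) == (nth 0 p a == nth 0 p b)]]].

Definition avoids (p w : seq nat) : bool := ~~ contains p w.

Definition descents (w : seq nat) : nat :=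
  #|[set i : 'I_(size w) | (i.+1 < size w) && (nth 0 w i.+1 < nth 0 w i)]|.

Definition letters n (t : n.-tuple 'I_n) : seq nat := [seq val i | i <- t].

(* Taking letters in 'I_n makes the words of length n a finite type and loses
   no Catalan word, by catalan_letters below. *)
Definition catalan_avoiding (n : nat) (p : seq nat) : {set n.-tuple 'I_n} :=
  [set t | catalan (letters t) && avoids p (letters t)].

Lemma catalan_nth w i : catalan w -> i < size w -> nth 0 w i <= i.
Proof.
case/andP=> /eqP w0 sw; elim: i => [|i IHi] lt_i; first by rewrite nth0 w0.
case: w sw {w0} IHi lt_i => //= a s /(pathP 0) sP IHi lt_i.
by apply: leq_trans (sP i lt_i) _; rewrite ltnS; apply: IHi; apply: ltnW.
Qed.

Lemma catalan_letters n (w : seq nat) :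
  size w = n -> catalan w -> exists t : n.-tuple 'I_n, letters t = w.
Proof.
move=> sz_w cat_w.
have lt_w (i : 'I_n) : nth 0 w i < n.
  by apply: leq_ltn_trans (ltn_ord i); apply: catalan_nth; rewrite ?sz_w.
exists [tuple Ordinal (lt_w i) | i < n]; rewrite /letters /= -map_comp.
apply: (@eq_from_nth _ 0) => [|i]; rewrite size_map size_enum_ord ?sz_w // => lti.
rewrite (nth_map (Ordinal lti)) ?size_enum_ord //=.
by rewrite nth_enum_ord.
Qed.

Local Open Scope ring_scope.

(* Formal power series in Z[[x, y]]: F n k is the coefficient of x^n y^k. *)
Definition series2 := nat -> nat -> int.

Definition series2_one : series2 := fun n k => ((n == 0%N) && (k == 0%N))%:R.

Definition series2_sub (F G : series2) : series2 := fun n k => F n k - G n k.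

Definition series2_mul (F G : series2) : series2 := fun n k =>
  \sum_(i < n.+1) \sum_(j < k.+1) F i j * G (n - i)%N (k - j)%N.

Definition series2_exp (F : series2) (m : nat) : series2 :=
  iter m (series2_mul F) series2_one.

(* The geometric series 1/G = \sum_m (1 - G)^m, for G of constant term 1: then
   (1 - G)^m has no term of total degree < m, so the terms m > n + k do not
   contribute to the coefficient of x^n y^k (see series2_mulV). *)
Definition series2_inv (G : series2) : series2 := fun n k =>
  \sum_(m < (n + k).+1) series2_exp (series2_sub series2_one G) m n k.

Definition series2_div (F G : series2) : series2 :=
  series2_mul F (series2_inv G).

(* The outer variable of {poly {poly int}} is x, the inner one is y. *)
Definition series2_of_poly (P : {poly {poly int}}) : series2 :=
  fun n k => P`_n`_k.

Definition varx : {poly {poly int}} := 'X.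
Definition vary : {poly {poly int}} := ('X)%:P.

Definition catalan_gf (p : seq nat) : series2 := fun n k =>
  #|[set t in catalan_avoiding n p | descents (letters t) == k]|%:Z.

Lemma series2_exp_small (F : series2) m n k :
  F 0%N 0%N = 0 -> (n + k < m)%N -> series2_exp F m n k = 0.
Proof.
move=> F0; elim: m n k => // m IHm n k lt_nk.
rewrite /series2_exp iterS /series2_mul.
apply: big1 => i _; apply: big1 => j _.
have [/eqP|ij0] := eqVneq (i + j)%N 0%N.
  by rewrite addn_eq0 => /andP[/eqP-> /eqP->]; rewrite F0 mul0r.
rewrite [X in _ * X](_ : _ = 0) ?mulr0 //; apply: IHm.
apply: (@leq_trans (n + k)%N); last by rewrite -ltnS.
have := ltn_ord i; have := ltn_ord j; rewrite !ltnS => lej lei.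
rewrite -[in X in (_ < X)%N](subnK lei) -[in X in (_ < X)%N](subnK lej).
by rewrite addnACA -[X in (X < _)%N]addn0 ltn_add2l lt0n.
Qed.

Lemma series2_mulV (G : series2) :
  G 0%N 0%N = 1 -> series2_mul G (series2_inv G) =2 series2_one.
Proof.
move=> G0 n k; pose E := series2_sub series2_one G.
have E0 : E 0%N 0%N = 0 by rewrite /E /series2_sub /series2_one /= G0 subrr.
have invE n' k' : (n' + k' <= n + k)%N ->
    series2_inv G n' k' = \sum_(m < (n + k).+1) series2_exp E m n' k'.
  move=> le_nk; rewrite /series2_inv -/E.
  rewrite -(big_mkord xpredT (fun m => series2_exp E m n' k')).
  rewrite -(big_mkord xpredT (fun m => series2_exp E m n' k')).
  rewrite [RHS](big_cat_nat (n := (n' + k').+1)) //=.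
  rewrite [X in _ + X]big_nat_cond [X in _ + X]big1 ?addr0 // => m.
  by rewrite andbT => /andP[lt_m _]; apply: series2_exp_small.
have GE i j : G i j = series2_one i j - E i j.
  by rewrite /E /series2_sub opprB addrC subrK.
have mul1 F : series2_mul series2_one F n k = F n k.
  rewrite /series2_mul big_ord_recl [X in _ + X]big1 => [|i _]; last first.
    by apply: big1 => j _; rewrite /series2_one mul0r.
  rewrite big_ord_recl big1 => [|j _]; last by rewrite /series2_one mul0r.
  by rewrite /series2_one mul1r !addr0 !subn0.
pose H : series2 := fun n' k' => \sum_(m < (n + k).+1) series2_exp E m n' k'.
transitivity (series2_mul series2_one H n k - series2_mul E H n k).
  rewrite /series2_mul -sumrB; apply: eq_bigr => i _.
  rewrite -sumrB; apply: eq_bigr => j _; rewrite -mulrBl -GE.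
  by rewrite invE // leq_add // leq_subr.
rewrite mul1 (_ : series2_mul E H n k =
    \sum_(m < (n + k).+1) series2_exp E m.+1 n k); last first.
  rewrite /series2_mul; under eq_bigr => i _.
    under eq_bigr => j _ do rewrite /H mulr_sumr.
    rewrite exchange_big; over.
  by rewrite exchange_big.
rewrite /H big_ord_recl [X in _ - X]big_ord_recr.
rewrite [X in _ - (_ + X)](series2_exp_small E0) ?ltnSn // addr0.
by rewrite addrK.
Qed.

(* Main.v *)
Require Import Defs.
From mathcomp Require Import all_boot all_order all_algebra.
From mathcomp Require Import zify ring.
Import GRing.Theory.
Local Open Scope ring_scope.

(** A non-empty Catalan word avoiding 100 is [0], or [0 :: w] with [w] a
    non-empty word of the same kind, or [0] followed by such a word [w] raised
    by one, in which at most one further [0] may be inserted, since two of them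
    would form a 100 with the [1] that precedes. The Catalan condition allows
    this insertion exactly at the end of [w] and before the non-initial zeros
    of [w], and it adds a descent unless it splits a descent of [w] to [0].
    Let [f n] and [i n] be the descent polynomials of the words of length [n]
    and of the raised words with an inserted [0]. Then
    [f (n+1) = [n = 0] + 2 f n + i n] and
    [i (n+2) = y f (n+1) + i (n+1) + i n]; eliminating [i] gives the linear
    recurrence encoded by the denominator. *)

(** * Recursive forms of avoidance and descents *)

(** The head can only play the 1 of the pattern, so an occurrence through it is a smaller value
    taken twice in the tail. *)
Fixpoint avoids100 (w : seq nat) : bool :=
  if w is a :: s then
    all (fun v => (v < a)%N ==> (count_mem v s <= 1)%N) s && avoids100 s
  else true.

Fixpoint des (w : seq nat) : nat :=
  if w is a :: s then
    (if s is b :: _ then nat_of_bool (b < a)%N else 0%N) + des s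
  else 0%N.

Lemma contains100P (w : seq nat) :
  reflect (exists i j k, [/\ (i < j)%N, (j < k)%N, (k < size w)%N,
             nth 0%N w j = nth 0%N w k & (nth 0%N w j < nth 0%N w i)%N])
          (contains [:: 1; 0; 0]%N w).
Proof.
apply: (iffP existsP) => [[f /forallP fP]|[i [j [k [ij jk kw eqjk ltji]]]]].
  pose o0 : 'I_(size [:: 1; 0; 0]%N) := @Ordinal 3 0 isT.
  pose o1 : 'I_(size [:: 1; 0; 0]%N) := @Ordinal 3 1 isT.
  pose o2 : 'I_(size [:: 1; 0; 0]%N) := @Ordinal 3 2 isT.
  have /forallP/(_ o1)/and3P[/= f01 _ _] := fP o0.
  have /forallP/(_ o0)/and3P[/= _ /eqP f10 _] := fP o1.
  have /forallP/(_ o2)/and3P[/= f12 _ /eqP/eqP f21] := fP o1.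
  by exists (f o0), (f o1), (f o2); split.
have iw : (i < size w)%N by lia.
have jw : (j < size w)%N by lia.
exists [ffun a : 'I_3 => tnth [tuple Ordinal iw; Ordinal jw; Ordinal kw] a].
apply/forallP=> a; apply/forallP=> b; rewrite !ffunE !(tnth_nth (Ordinal iw)).
case: a => [[|[|[|//]]] ?]; case: b => [[|[|[|//]]] ?]; rewrite /=; lia.
Qed.

Lemma mem_nth_ex (s : seq nat) (a : nat) :
  a \in s -> exists2 i, (i < size s)%N & nth 0%N s i = a.
Proof. by move=> sa; exists (index a s); rewrite ?index_mem ?nth_index. Qed.

Lemma count_mem_gt1P (v : nat) (s : seq nat) :
  reflect (exists j k, [/\ (j < k)%N, (k < size s)%N, nth 0%N s j = v
                         & nth 0%N s k = v])
          (1 < count_mem v s)%N.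
Proof.
apply: (iffP idP).
  elim: s => // a s IHs /=; have [->|av] /= := eqVneq a v.
    rewrite add1n ltnS -has_count has_pred1 => /mem_nth_ex[k ks <-].
    by exists 0%N, k.+1.
  by rewrite add0n => /IHs[j [k [? ? ? ?]]]; exists j.+1, k.+1.
elim: s => [|a s IHs] [j [k [jk ks vj vk]]] //=.
case: k j => [//|k] [|j] in jk ks vj vk *.
  rewrite /= in vj; rewrite vj eqxx add1n ltnS -has_count has_pred1 -vk /=.
  by rewrite mem_nth.
by apply: ltn_addl; apply: IHs; exists j, k.
Qed.

Lemma avoids100E (w : seq nat) : avoids [:: 1; 0; 0]%N w = avoids100 w.
Proof.
rewrite /avoids; apply/negP/idP => [noc|].
  have {noc}: ~ exists i j k, [/\ (i < j)%N, (j < k)%N, (k < size w)%N,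
             nth 0%N w j = nth 0%N w k & (nth 0%N w j < nth 0%N w i)%N].
    by move=> ex; apply: noc; apply/contains100P.
  elim: w => //= a s IHs noc; apply/andP; split; last first.
    apply: IHs => -[i [j [k [? ? ? ? ?]]]]; apply: noc.
    by exists i.+1, j.+1, k.+1.
  apply/allP=> v _; apply/implyP=> va; rewrite leqNgt.
  apply/count_mem_gt1P=> -[j [k [jk ks vj vk]]]; apply: noc.
  by exists 0%N, j.+1, k.+1; split; rewrite //= ?vj ?vk.
move=> avw /contains100P; move: avw.
elim: w => [_ [i [j [k [? ? //]]]]|a s IHs /= /andP[/allP sP avs]].
move=> [i [[|j] [[|k] [//= ij jk ks eqjk ltji]]]].
case: i ij ltji => [|i] ij ltji; last by apply: IHs => //; exists i, j, k.
have jks : (j < size s)%N by lia.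
have /= := sP _ (mem_nth 0%N jks); rewrite ltji /= leqNgt.
by move=> /count_mem_gt1P; apply; exists j, k.
Qed.

Lemma descentsE (w : seq nat) : descents w = des w.
Proof.
rewrite /descents -sum1dep_card big_mkcond /=.
elim: w => [|a s IHs]; first by rewrite big_ord0.
rewrite /= big_ord_recl -IHs /=; congr (_ + _)%N.
by case: s {IHs} => //= b s; case: ifP.
Qed.

(** * Raising letters and inserting a zero *)

Lemma avoids100_succ (s : seq nat) : avoids100 (map succn s) = avoids100 s.
Proof.
elim: s => //= a s ->; rewrite all_map; congr (_ && _).
by apply: eq_all => v /=; rewrite ltnS count_map.
Qed.

(** The inserted letter is the only 0: no other letter equals it, so it is neither zero of the
    pattern, and nothing lies below it, so it is not the 1. Every occurrence lies in the raised
    letters. *)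
Lemma avoids100_insert (u v : seq nat) :
  avoids100 (map succn u ++ 0%N :: map succn v) = avoids100 (u ++ v).
Proof.
elim: u => [|a u IHu] /=.
  by rewrite avoids100_succ; case: (X in X && _) / allP => // -[].
rewrite IHu !all_cat /= !all_map; congr (_ && _).
have cnt0 t : count_mem 0%N (map succn t) = 0%N.
  by rewrite count_map; apply/eqP; rewrite eqn0Ngt -has_count; apply/hasPn.
have cntS t x : count_mem x.+1 (map succn t) = count_mem x t.
  by rewrite count_map.
rewrite !count_cat /= !cnt0 /=.
by congr (_ && _); apply: eq_all => x /=; rewrite !count_cat /= !cntS ltnS.
Qed.

Lemma catalan_succ (v : seq nat) :
  catalan (0%N :: map succn v) = catalan v.
Proof.
by case: v => //= a v; rewrite /catalan /= path_map ltnS leqn0.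
Qed.

(** A 0 may follow any letter, so the condition splits there; after it, the first raised letter is
    at most 1, which forces [v] to be empty or to start with 0. *)
Lemma catalan_insert (u v : seq nat) :
  catalan (0%N :: map succn u ++ 0%N :: map succn v) = catalan u && catalan v.
Proof.
by rewrite -(catalan_succ u) -(catalan_succ v) /catalan /= cat_path.
Qed.

Lemma catalan_cat (u v : seq nat) : u != [::] -> head 0%N v = 0%N ->
  catalan (u ++ v) = catalan u && catalan v.
Proof.
case: u => // a u _; rewrite /catalan /= cat_path => v0.
by rewrite v0 /= -!andbA; case: v v0 => //= b v ->.
Qed.

Lemma des_succ (s : seq nat) : des (map succn s) = des s.
Proof. by elim: s => //= a s ->; case: s. Qed.

Lemma des_cons0 (s : seq nat) : des (0%N :: s) = des s.
Proof. by case: s. Qed.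

(* The words obtained from [w] by raising every letter by one and inserting a
   single [0], either at the end or just before a non-initial letter [0]. *)
Fixpoint insertions (w : seq nat) : seq (seq nat) :=
  if w is a :: s then
    (if head 0%N s == 0%N then [:: a.+1 :: 0%N :: map succn s] else [::])
      ++ map (cons a.+1) (insertions s)
  else [::].

Lemma mem_insertionsP (w x : seq nat) :
  reflect (exists u v, [/\ w = u ++ v, u != [::], head 0%N v = 0%N
             & x = map succn u ++ 0%N :: map succn v])
          (x \in insertions w).
Proof.
elim: w x => [|a s IHs] x /=.
  by right=> -[[|? ?] [v [//]]].
rewrite mem_cat; apply: (iffP orP) => [[]|].
- case: eqP => // s0; rewrite inE => /eqP->.
  by exists [:: a], s.
- case/mapP=> y /IHs[u [v [-> u0 v0 ->]]] ->.
  by exists (a :: u), v.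
case=> -[|b u] [v [//= [<- def_s] _ v0 ->]].
case: u def_s => [|c u] def_s; first by left; rewrite def_s v0 /= inE.
by right; apply: map_f; apply/IHs; exists (c :: u), v.
Qed.

Lemma uniq_insertions (w : seq nat) : uniq (insertions w).
Proof.
elim: w => //= a s IHs; rewrite cat_uniq map_inj_uniq ?IHs; last first.
  by move=> ? ? [].
rewrite andbT has_sym; case: eqP => //= _; rewrite orbF.
apply/negP=> /mapP[y /mem_insertionsP[[|b u] [v [//= _ _ _ ->]]]].
by case.
Qed.

(** This left inverse makes the insertions of different words disjoint. *)
Lemma insertions_inv (w x : seq nat) :
  x \in insertions w -> w = map predn (filter (fun a => 0 < a)%N x).
Proof.
case/mem_insertionsP=> u [v [-> _ _ ->]].
have pos t : [seq a <- map succn t | (0 < a)%N] = map succn t.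
  by apply/all_filterP; rewrite all_map; apply/allP.
rewrite filter_cat /= !pos -map_cat -map_comp.
by rewrite [RHS](eq_map (g := id)) ?map_id.
Qed.

(** * Enumeration of the non-empty words without repetition *)

(** The empty word is left out, since the second and third blocks would both turn it into the word
    0. The last block is [inserted m], unfolded to keep the recursion structural. *)
Fixpoint words (n : nat) : seq (seq nat) :=
  if n is m.+1 then
    (if m is 0%N then [:: [:: 0%N]] else [::])
      ++ map (cons 0%N) (words m)
      ++ map (fun w => 0%N :: map succn w) (words m)
      ++ map (cons 0%N) (if m is l.+1 then flatten (map insertions (words l))
                         else [::])
  else [::].

Definition inserted (n : nat) : seq (seq nat) :=
  if n is m.+1 then flatten (map insertions (words m)) else [::].

Lemma wordsS (n : nat) :
  words n.+1 = (if n is 0%N then [:: [:: 0%N]] else [::])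
      ++ map (cons 0%N) (words n)
      ++ map (fun w => 0%N :: map succn w) (words n)
      ++ map (cons 0%N) (inserted n).
Proof. by case: n. Qed.

(** The induction is strong because the last block goes back two lengths. Conversely, the block of a
    longer word is determined by whether its second letter is 0 and, if not, whether a further 0
    occurs. *)
Lemma mem_words (n : nat) (w : seq nat) :
  (w \in words n) = [&& (0 < n)%N, size w == n, catalan w & avoids100 w].
Proof.
elim/ltn_ind: n w => -[|n] IHn w //.
rewrite wordsS !mem_cat /=; apply/idP/idP.
  case/or4P.
  - by case: n IHn => // _; rewrite inE => /eqP->.
  - case/mapP=> s; rewrite IHn // => /and4P[n0 /eqP<- /andP[s0 ps] avs] ->.
    rewrite /= eqxx /= avs andbT; apply/andP; split.
      by case: s s0 ps {n0 avs} => //= b s /eqP-> ps; rewrite /catalan /= ps.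
    by apply/allP.
  - case/mapP=> s; rewrite IHn // => /and4P[n0 /eqP<- cs avs] ->.
    rewrite catalan_succ cs /= size_map eqxx avoids100_succ avs andbT.
    by apply/allP.
  case/mapP=> s ins ->; rewrite /inserted in ins.
  case: n IHn ins => // n IHn /flattenP[l /mapP[t]].
  rewrite IHn // => /and4P[n0 /eqP st ct avt] -> /mem_insertionsP[u [v]].
  case=> def_t u0 v0 ->; rewrite catalan_insert -catalan_cat // -def_t ct /=.
  rewrite avoids100_insert -def_t avt andbT size_cat /= !size_map addnS.
  by rewrite -size_cat -def_t st eqxx; apply/allP.
case/and3P=> /eqP; case: w => //= a s [sn] /andP[/= /eqP a0 ps] /andP[_ avs].
subst a; case: s => [|b s] in sn ps avs *; first by rewrite -sn.
have sn0 : (0 < n)%N by rewrite -sn.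
have map0 (t : seq nat) : 0%N \notin t -> exists u, t = map succn u.
  move=> t0; exists (map predn t); rewrite -map_comp -[LHS]map_id.
  by apply/eq_in_map => -[|x] //= tx; rewrite tx in t0.
have [b0|b0] := eqVneq b 0%N.
  apply/or4P; apply: Or42; apply: map_f; rewrite IHn // sn0 -sn eqxx avs andbT.
  by move: ps; rewrite b0 /catalan.
have [in0|/map0[u def_u]] := boolP (0%N \in b :: s); last first.
  apply/or4P; apply: Or43; rewrite def_u.
  apply: (map_f (fun w => 0%N :: map succn w)); rewrite IHn // sn0 -sn def_u.
  rewrite size_map eqxx -avoids100_succ -def_u avs andbT.
  by rewrite -catalan_succ -def_u /catalan.
apply/or4P; apply: Or44; apply: map_f.
(* The letter [b] is positive, so two zeros after it would form a 100. *)
have cnt : (count_mem 0 (b :: s) <= 1)%N.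
  have sin0 : 0%N \in s by move: in0; rewrite inE eq_sym (negPf b0).
  rewrite /= (negPf b0).
  by move: avs => /= /andP[/allP/(_ _ sin0)]; rewrite lt0n b0.
have bs0 : head 0%N (b :: s) != 0%N by [].
have cs : catalan (0%N :: b :: s) by rewrite /catalan.
case: n sn sn0 IHn => // n sn _ IHn; move: sn cs avs cnt bs0.
case/splitPr: in0 => p1 p2 sn cs avs.
rewrite count_cat /= add1n addnS ltnS leqn0 addn_eq0.
case/andP=> cnt1 cnt2 p10.
have /map0[u def_u] : 0%N \notin p1 by rewrite -has_pred1 has_count -eqn0Ngt.
have /map0[v def_v] : 0%N \notin p2 by rewrite -has_pred1 has_count -eqn0Ngt.
rewrite def_u def_v size_cat /= !size_map in sn cs avs p10 *.
rewrite catalan_insert avoids100_insert in cs avs.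
have u0 : u != [::] by case: (u) p10.
case/andP: cs => cu cv; have v0 : head 0%N v = 0%N by case/andP: cv => /eqP.
apply/flattenP; exists (insertions (u ++ v)); last first.
  by apply/mem_insertionsP; exists u, v.
apply: map_f; rewrite IHn // catalan_cat // cu cv avs size_cat.
have : (0 < size u)%N by case: (u) u0.
lia.
Qed.

(** Since [g] recovers [x] from any element of [f x], the lists of distinct entries cannot meet. *)
Lemma uniq_flatten_map (S T : eqType) (f : S -> seq T) (g : T -> S) s :
    (forall x, uniq (f x)) -> (forall x y, y \in f x -> x = g y) ->
  uniq s -> uniq (flatten (map f s)).
Proof.
move=> uf fg; elim: s => //= x s IHs /andP[xs us].
rewrite cat_uniq uf IHs // andbT; apply/hasPn=> y /flattenP[l /mapP[z zs ->]].
move=> /fg zE; apply/negP=> /fg xE; by rewrite xE -zE zs in xs.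
Qed.

(** The two properties separate these words from those starting with 0 and from the raised ones,
    respectively. *)
Lemma head_inserted n x : x \in inserted n -> head 0%N x != 0%N /\ 0%N \in x.
Proof.
case: n => // n /flattenP[l /mapP[t _ ->] /mem_insertionsP[u [v [_ u0 _ ->]]]].
by split; [case: u u0 | rewrite mem_cat inE eqxx orbT].
Qed.

Lemma head_words n w : w \in words n -> exists s, w = 0%N :: s.
Proof.
rewrite mem_words => /and4P[n0 /eqP sw /andP[/eqP w0 _] _].
by case: w sw w0 => [sw|a s _ /= ->]; [rewrite -sw in n0 | exists s].
Qed.

Lemma uniq_words n : uniq (words n).
Proof.
elim/ltn_ind: n => -[|n] IHn //; rewrite wordsS.
have uI : uniq (inserted n).
  case: n IHn => // n IHn; apply: uniq_flatten_map.
  - exact: uniq_insertions.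
  - exact: insertions_inv.
  exact: IHn.
have un := IHn n (ltnSn n).
have succ_inj : injective (fun w => 0%N :: map succn w).
  by move=> w1 w2 [/(inj_map succn_inj)].
rewrite 3!cat_uniq !map_inj_uniq ?un ?uI //; try by move=> ? ? [].
rewrite !andbT /=; apply/and4P; split.
- by case: (n).
- by apply/hasPn=> x; case: n {IHn un uI} => //.
- apply/hasPn=> x; rewrite mem_cat => /orP[]/mapP[y yI ->]; apply/mapP.
    case=> z /head_words[s ->] [] /esym.
    by have [t ->] := head_words _ _ yI.
  case=> z /head_words[s ->] [yE].
  by case: (head_inserted _ _ yI); rewrite yE.
- apply/hasPn=> x /mapP[y /head_inserted[_ y0] ->]; apply/mapP=> -[z _ [yE]].
  by rewrite yE in y0; case/mapP: y0.
Qed.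

(** * Descent polynomials and their recurrences *)

Definition words_gf (n : nat) : {poly int} := \sum_(w <- words n) 'X^(des w).

Definition inserted_gf (n : nat) : {poly int} :=
  \sum_(w <- inserted n) 'X^(des w).

(* An insertion creates a new descent, unless it takes place inside a descent
   to [0]. *)
Fixpoint insertion_weight (w : seq nat) : {poly int} :=
  if w is a :: s then
    if s is b :: _ then
      (if b == 0%N then (if (0 < a)%N then 1 else 'X) else 0)
        + insertion_weight s
    else 'X
  else 0.

Lemma insertions_gf (w : seq nat) :
  \sum_(x <- insertions w) 'X^(des x) = insertion_weight w * 'X^(des w).
Proof.
elim: w => [|a s IHs]; first by rewrite big_nil mul0r.
case: s IHs => [|b s] IHs.
  by rewrite /= big_cons big_nil /= addr0 mulr1.
have -> : insertions (a :: b :: s) =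
    (if b == 0%N then [:: a.+1 :: 0%N :: map succn (b :: s)] else [::])
      ++ map (cons a.+1) (insertions (b :: s)) by [].
rewrite big_cat big_map.
(* A later insertion keeps [b.+1] as second letter, hence its comparison with the first. *)
have -> : \sum_(x <- insertions (b :: s)) 'X^(des (a.+1 :: x)) =
    'X^(b < a)%N * \sum_(x <- insertions (b :: s)) 'X^(des x) :> {poly int}.
  rewrite mulr_sumr; apply: eq_big_seq => x.
  case/mem_insertionsP=> -[|c u] [v [//= [<- _] _ _ ->]].
  by rewrite -exprD.
have -> : des (a :: b :: s) = ((b < a)%N + des (b :: s))%N by [].
rewrite IHs [insertion_weight (a :: _)]/= mulrDl.
congr (_ + _); last by rewrite exprD mulrCA.
rewrite exprD; case: eqP => [->|_]; last by rewrite big_nil mul0r.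
rewrite big_seq1.
(* The inserted 0 always ends a descent from [a.+1]; the original word has a descent at this place
   only if [a] is positive. *)
have -> : des (a.+1 :: 0%N :: map succn (0%N :: s)) = (des (0%N :: s)).+1.
  by rewrite -[RHS]add1n -(des_succ (0%N :: s)) -(des_cons0 (map _ _)).
by case: a => [|a]; rewrite /= ?expr0 ?expr1 ?mul1r -?exprS.
Qed.

(** Without a letter 0, the end is the only place for an insertion. *)
Lemma insertion_weight_succ (s : seq nat) :
  s != [::] -> insertion_weight (map succn s) = 'X.
Proof. by elim: s => //= a [|b s] //= IHs _; rewrite add0r IHs. Qed.

(** There are two places: before the only 0, inside the descent to it, and at the end. *)
Lemma insertion_weight_insert (u v : seq nat) : u != [::] ->
  insertion_weight (map succn u ++ 0%N :: map succn v) = 1 + 'X.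
Proof.
elim: u => //= a [|b u] IHu _ /=; last by rewrite add0r -IHu.
case: v {IHu} => [|b v] //=; congr (_ + _); rewrite add0r.
exact: (insertion_weight_succ (b :: v)).
Qed.

Lemma words_gfS (n : nat) :
  words_gf n.+1 = (n == 0%N)%:R + words_gf n *+ 2 + inserted_gf n.
Proof.
rewrite /words_gf wordsS !big_cat !big_map /= mulr2n -!addrA.
under [X in _ + (_ + (X + _))]eq_bigr => w _
  do rewrite -/(des (0%N :: _)) des_cons0 des_succ.
under [X in _ + (X + _)]eq_bigr => w _ do rewrite -/(des (0%N :: _)) des_cons0.
under [X in _ + (_ + (_ + X))]eq_bigr => w _
  do rewrite -/(des (0%N :: _)) des_cons0.
by congr (_ + _); case: n => [|n]; rewrite ?big_cons big_nil ?addr0.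
Qed.

Lemma inserted_gfS (n : nat) :
  inserted_gf n.+1 = \sum_(w <- words n) insertion_weight w * 'X^(des w).
Proof.
rewrite /inserted_gf /= big_flatten big_map /=.
by apply: eq_bigr => w _; rewrite insertions_gf.
Qed.

(** Every word of length [n.+1] has weight at least ['X], which gives the first term. The excess is
    the weight of [w] for [0 :: w] with [w] in [words n], and 1 for [0 :: w] with [w] in
    [inserted n]; it gives the other two terms. *)
Lemma inserted_gfSS (n : nat) :
  inserted_gf n.+2 = 'X * words_gf n.+1 + inserted_gf n.+1 + inserted_gf n.
Proof.
rewrite words_gfS !inserted_gfS wordsS !big_cat !big_map.
have -> : \sum_(w <- words n) insertion_weight (0%N :: w) * 'X^(des (0%N :: w))
    = 'X * words_gf n + \sum_(w <- words n) insertion_weight w * 'X^(des w).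
  rewrite /words_gf mulr_sumr -big_split.
  apply: eq_big_seq => w /head_words[s ->].
  by rewrite des_cons0; exact: mulrDl.
have -> : \sum_(w <- words n) insertion_weight (0%N :: map succn w)
    * 'X^(des (0%N :: map succn w)) = 'X * words_gf n.
  rewrite /words_gf mulr_sumr; apply: eq_big_seq => w /head_words[s ->].
  rewrite des_cons0 des_succ; congr (_ * _) => /=.
  by rewrite add0r; exact: (insertion_weight_succ (0%N :: s)).
have -> : \sum_(w <- inserted n) insertion_weight (0%N :: w)
    * 'X^(des (0%N :: w)) = (1 + 'X) * inserted_gf n.
  rewrite /inserted_gf mulr_sumr; apply: eq_big_seq => w.
  case: (n) => // m /flattenP[l /mapP[t _ ->]].
  case/mem_insertionsP=> u [v [_ u0 _ ->]].
  rewrite des_cons0 -(insertion_weight_insert u v u0); congr (_ * _).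
  by case: u u0 => //= a u _; rewrite add0r.
have -> : \sum_(w <- (if n is 0%N then [:: [:: 0%N]] else [::]))
    insertion_weight w * 'X^(des w) = 'X * (n == 0%N)%:R.
  by case: n => [|n]; rewrite ?big_cons big_nil /= ?addr0 ?mulr0.
rewrite /=; ring.
Qed.

(** The first summand restores the empty word. *)
Definition descent_poly (n : nat) : {poly int} := (n == 0%N)%:R + words_gf n.

(** The map [letters] is injective and, by [catalan_letters], reaches every word of the list. *)
Lemma catalan_gfE (n k : nat) :
  catalan_gf [:: 1; 0; 0]%N n k = (descent_poly n)`_k.
Proof.
pose s := if n is 0%N then [:: [::]] else words n.
have mem_s w : (w \in s) = [&& size w == n, catalan w & avoids100 w].
  by rewrite /s; case: (n) => [|m]; [case: w | rewrite mem_words].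
have us : uniq s by rewrite /s; case: (n) => // m; apply: uniq_words.
have -> : descent_poly n = \sum_(w <- s) 'X^(des w).
  rewrite /descent_poly /s /words_gf; case: (n) => [|m]; last by rewrite add0r.
  by rewrite big_nil big_cons big_nil.
have -> : (\sum_(w <- s) 'X^(des w) : {poly int})`_k
    = (count (fun w => des w == k) s)%:R.
  rewrite coef_sum -sum1_count natr_sum [RHS]big_mkcond; apply: eq_bigr => w _.
  by rewrite coefXn eq_sym; case: eqP.
rewrite /catalan_gf natz; congr Posz.
rewrite -size_filter cardE -(size_map (@letters n)); apply: perm_size.
have inj_letters : injective (@letters n).
  by move=> t1 t2 /(inj_map val_inj)/val_inj.
apply: uniq_perm; rewrite ?(map_inj_uniq inj_letters) ?enum_uniq ?filter_uniq //.
move=> w; rewrite mem_filter mem_s; apply/mapP/and4P.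
  case=> t; rewrite mem_enum !inE avoids100E descentsE.
  by case/andP=> /andP[? ?] ? ->; rewrite size_map size_tuple.
case=> dw /eqP sw cw aw; have [t tE] := catalan_letters sw cw.
by exists t; rewrite // mem_enum !inE tE avoids100E descentsE cw aw.
Qed.

(** * Division of power series through polynomial truncations *)

(** A coefficient of a product depends only on coefficients of no larger degrees, so the ring laws
    of polynomials can replace those of series. *)
Definition approx (n k : nat) (P : {poly {poly int}}) (F : series2) : Prop :=
  forall i j, (i <= n)%N -> (j <= k)%N -> P`_i`_j = F i j.

Lemma approx_mul n k P Q F G : approx n k P F -> approx n k Q G ->
  approx n k (P * Q) (series2_mul F G).
Proof.
move=> PF QG i j lei lej; rewrite coefM coef_sum; apply: eq_bigr => a _.
rewrite coefM; apply: eq_bigr => b _.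
have := ltn_ord a; have := ltn_ord b; rewrite !ltnS => leb lea.
by rewrite PF ?QG //; lia.
Qed.

Lemma approx_trunc n k F :
  approx n k (\poly_(i < n.+1) \poly_(j < k.+1) F i j) F.
Proof.
by move=> i j lei lej; rewrite !coef_poly !ltnS lei coef_poly ltnS lej.
Qed.

Lemma approx1 n k : approx n k 1 series2_one.
Proof. by move=> [|i] j _ _; rewrite coef1 /= ?coef0 ?coef1. Qed.

(** On truncations, both sides are read off the product of [G], [H] and the inverse of [G], grouped
    in two ways. *)
Lemma series2_divE (F G H : series2) : G 0%N 0%N = 1 ->
  series2_mul G H =2 F -> H =2 series2_div F G.
Proof.
move=> G0 GH n k.
pose T (E : series2) := \poly_(i < n.+1) \poly_(j < k.+1) E i j.
have TE E : approx n k (T E) E by exact: approx_trunc.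
have TF : approx n k (T G * T H) F.
  by move=> i j lei lej; rewrite -GH; apply: approx_mul.
have T1 : approx n k (T G * T (series2_inv G)) series2_one.
  by move=> i j lei lej; rewrite -(series2_mulV G0); apply: approx_mul.
rewrite /series2_div -(approx_mul _ _ _ _ _ _ TF (TE (series2_inv G))) // mulrAC.
rewrite (approx_mul _ _ _ _ _ _ T1 (TE H)) //.
by rewrite -(approx_mul _ _ _ _ _ _ (@approx1 n k) (TE H)) // mul1r TE.
Qed.

Theorem theorem11 :
  let x := varx in
  let y := vary in
  catalan_gf [:: 1; 0; 0]%N =2
    series2_div
      (series2_of_poly (1 - 2 * x - x ^+ 2 * y + x ^+ 3))
      (series2_of_poly (1 - 3 * x + x ^+ 2 - x ^+ 2 * y + 2 * x ^+ 3)).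
Proof.
move=> x y.
set N := 1 - 2 * x - _ + _; set D := 1 - 3 * x + _ - _ + _.
(* Collecting powers of x makes each coefficient of [D * P] a combination of shifted coefficients of
   [P]. *)
have NE : N = 1%:P + (- 2)%:P * 'X + (- 'X)%:P * 'X^2 + 1%:P * 'X^3.
  by rewrite /N /x /y /varx /vary !polyCN polyC_natr; ring.
have DE : D = 1%:P + (- 3)%:P * 'X + (1 - 'X)%:P * 'X^2 + 2%:P * 'X^3.
  by rewrite /D /x /y /varx /vary polyCB !polyCN !polyC_natr; ring.
apply: series2_divE => [|i j].
  rewrite /series2_of_poly; suff -> : D`_0 = 1 by rewrite coef1.
  by rewrite DE !coefD !coefCM coefX !coefXn coefC /= !mulr0 !addr0.
pose P : {poly {poly int}} := \poly_(m < i.+1) descent_poly m.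
have P_C : approx i j P (catalan_gf [:: 1; 0; 0]%N).
  by move=> a b lea _; rewrite coef_poly ltnS lea catalan_gfE.
have DD : approx i j D (series2_of_poly D) by [].
rewrite -(approx_mul _ _ _ _ _ _ DD P_C) // /series2_of_poly.
suff -> : (D * P)`_i = N`_i by [].
have w0 : words_gf 0 = 0 by rewrite /words_gf big_nil.
have i0 : inserted_gf 0 = 0 by rewrite /inserted_gf big_nil.
have i1 : inserted_gf 1 = 0 by rewrite inserted_gfS big_nil.
rewrite DE NE !mulrDl !coefD -!mulrA !coefCM !coefXM /P !coef_poly.
rewrite !coefX coefC.
(* The recurrence has order 3; the lower degrees compare initial values. *)
case: i {P P_C DD} => [|[|[|i]]] /=.
- rewrite /descent_poly w0 /=; ring.
- rewrite /descent_poly /= words_gfS w0 i0 /=; ring.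
- rewrite /descent_poly /= !words_gfS w0 i0 i1 /=; ring.
(* At [i = 0] the empty word contributes 2 and the non-empty words -1, which leaves the coefficient
   1 of the cube of x in [N]. *)
rewrite !ltnS !leqW ?leqnn // eqSS /descent_poly /=.
rewrite (words_gfS i.+2) inserted_gfSS (words_gfS i.+1) (words_gfS i) /=.
ring.
Qed.
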